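(* Let $f(x)=a_dx^d+a_{d-1}x^{d-1}+\cdots+a_1x+1$ be a polynomial of degree $d$ with coefficients in $\mathbb{Z}_3$. Set $a_i=0$ for $i>d$, and $$A_0=\sum_{i\geq 2,\ i\text{ even}}a_i,\quad A_1=\sum_{i\geq 1,\ i\text{ odd}}a_i,\quad D_0=\sum_{i\geq 2,\ i\text{ even}}i\,a_i,\quad D_1=\sum_{i\geq 1,\ i\text{ odd}}i\,a_i.$$ Then the dynamical system $(\mathbb{Z}_3,f)$ is minimal if and only if $A_0\in 3\mathbb{Z}_3$, $A_1\in 1+3\mathbb{Z}_3$, and at least one of the following four conditions holds: (1) $D_0\equiv 0\ [3]$, $D_1\equiv 2\ [3]$, $a_1\equiv 1\ [3]$, $A_1+5\not\equiv 0\ [9]$ and $A_1+5\not\equiv 3a_2+3\sum_{j\geq 0}a_{5+6j}\ [9]$; (2) $D_0\equiv 0\ [3]$, $D_1\equiv 1\ [3]$, $a_1\equiv 1\ [3]$, $A_0+6\not\equiv 0\ [9]$ and $A_0+6\not\equiv 6a_2+3\sum_{j\geq 0}a_{2+6j}\ [9]$; (3) $D_0\equiv 1\ [3]$, $D_1\equiv 0\ [3]$, $a_1\equiv 2\ [3]$, $A_1+5\not\equiv 0\ [9]$ and $A_1+5\not\equiv 6a_2+3\sum_{j\geq 0}a_{5+6j}\ [9]$; (4) $D_0\equiv 2\ [3]$, $D_1\equiv 0\ [3]$, $a_1\equiv 2\ [3]$, $A_0+6\not\equiv 0\ [9]$ and $A_0+6\not\equiv 3a_2+3\sum_{j\geq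 0}a_{2+6j}\ [9]$.
   Context: $\mathbb{Z}_3$ is the ring of 3-adic integers with its usual (3-adic) topology. For $x,y\in\mathbb{Z}_3$ and $m\in\{3,9\}$, $x\equiv y\ [m]$ means $x-y\in m\mathbb{Z}_3$. The polynomial $f$ is viewed as the map $\mathbb{Z}_3\to\mathbb{Z}_3$, $x\mapsto f(x)$. The dynamical system $(\mathbb{Z}_3,f)$ is minimal if every orbit $\{f^n(x): n\geq 0\}$, $x\in\mathbb{Z}_3$, is dense in $\mathbb{Z}_3$, where $f^n$ is the $n$-fold composition. *)

(* Defs.v *)
From HB Require Import structures.
From mathcomp Require Import all_boot all_order all_algebra.
From mathcomp Require Import all_classical topology_structure.

Set Implicit Arguments.
Unset Strict Implicit.
Unset Printing Implicit Defensive.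

Import GRing.Theory Num.Theory.

Local Open Scope classical_set_scope.
Local Open Scope ring_scope.

(* The 3-adic integers as the inverse limit of the rings Z/3^n: the component
   [z3res x n] is the representative in [0, 3^n) of x modulo 3^n (the range is
   forced by the compatibility equation). *)
Record Z3 := MkZ3 {
  z3res :> nat -> int;
  z3resP : forall n, z3res n = (z3res n.+1 %% 3 ^+ n)%Z }.

Lemma z3_eqP (x y : Z3) : (forall n, x n = y n) -> x = y.
Proof.
case: x y => [x xP] [y yP] /= /funext exy; case: y / exy yP => yP.
by congr MkZ3; exact: Prop_irrelevance.
Qed.

Lemma z3res_small (x : Z3) n : (x n %% 3 ^+ n)%Z = x n.
Proof. by rewrite z3resP modz_mod. Qed.

Lemma modz_pow3S (m : int) n : ((m %% 3 ^+ n.+1)%Z %% 3 ^+ n)%Z = (m %% 3 ^+ n)%Z.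
Proof.
by rewrite {2}(divz_eq m (3 ^+ n.+1)) exprS mulrA modzMDl.
Qed.

Lemma z3_of_int_subproof (m : int) n :
  (m %% 3 ^+ n)%Z = ((m %% 3 ^+ n.+1)%Z %% 3 ^+ n)%Z.
Proof. by rewrite modz_pow3S. Qed.

Definition z3_of_int (m : int) : Z3 := MkZ3 (z3_of_int_subproof m).

Lemma z3_add_subproof (x y : Z3) n :
  ((x n + y n) %% 3 ^+ n)%Z = (((x n.+1 + y n.+1) %% 3 ^+ n.+1)%Z %% 3 ^+ n)%Z.
Proof. by rewrite modz_pow3S !(z3resP _ n) modzDm. Qed.

Lemma z3_opp_subproof (x : Z3) n :
  ((- x n) %% 3 ^+ n)%Z = (((- x n.+1) %% 3 ^+ n.+1)%Z %% 3 ^+ n)%Z.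
Proof. by rewrite modz_pow3S (z3resP _ n) modzNm. Qed.

Lemma z3_mul_subproof (x y : Z3) n :
  ((x n * y n) %% 3 ^+ n)%Z = (((x n.+1 * y n.+1) %% 3 ^+ n.+1)%Z %% 3 ^+ n)%Z.
Proof. by rewrite modz_pow3S !(z3resP _ n) modzMm. Qed.

Definition z3_add (x y : Z3) : Z3 := MkZ3 (z3_add_subproof x y).
Definition z3_opp (x : Z3) : Z3 := MkZ3 (z3_opp_subproof x).
Definition z3_mul (x y : Z3) : Z3 := MkZ3 (z3_mul_subproof x y).

HB.instance Definition _ := gen_eqMixin Z3.
HB.instance Definition _ := gen_choiceMixin Z3.

Lemma z3_addA : associative z3_add.
Proof. by move=> x y z; apply: z3_eqP => n /=; rewrite modzDml modzDmr addrA. Qed.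

Lemma z3_addC : commutative z3_add.
Proof. by move=> x y; apply: z3_eqP => n /=; rewrite addrC. Qed.

Lemma z3_add0 : left_id (z3_of_int 0) z3_add.
Proof. by move=> x; apply: z3_eqP => n /=; rewrite modzDml add0r z3res_small. Qed.

Lemma z3_addN : left_inverse (z3_of_int 0) z3_opp z3_add.
Proof. by move=> x; apply: z3_eqP => n /=; rewrite modzDml addNr. Qed.

HB.instance Definition _ :=
  GRing.isZmodule.Build Z3 z3_addA z3_addC z3_add0 z3_addN.

Lemma z3_mulA : associative z3_mul.
Proof. by move=> x y z; apply: z3_eqP => n /=; rewrite modzMml modzMmr mulrA. Qed.

Lemma z3_mulC : commutative z3_mul.
Proof. by move=> x y; apply: z3_eqP => n /=; rewrite mulrC. Qed.

Lemma z3_mul1 : left_id (z3_of_int 1) z3_mul.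
Proof. by move=> x; apply: z3_eqP => n /=; rewrite modzMml mul1r z3res_small. Qed.

Lemma z3_mulD : left_distributive z3_mul z3_add.
Proof.
by move=> x y z; apply: z3_eqP => n /=; rewrite modzMml modzDm mulrDl.
Qed.

Lemma z3_1neq0 : z3_of_int 1 != 0 :> Z3.
Proof. by apply/eqP => /(congr1 (fun x : Z3 => x 1)). Qed.

HB.instance Definition _ :=
  GRing.Zmodule_isComNzRing.Build Z3 z3_mulA z3_mulC z3_mul1 z3_mulD z3_1neq0.

Definition z3_multiples (m : nat) : set Z3 := [set m%:R * z | z in [set: Z3]].

Definition z3_cong (m : nat) (x y : Z3) : Prop := z3_multiples m (x - y).

(* The 3-adic topology: the balls x + 3^n Z_3 form a neighbourhood basis of x. *)
Definition z3_ball (x : Z3) (n : nat) : set Z3 := [set y | z3_cong (3 ^ n) y x].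

Definition z3_nbhs (x : Z3) : set_system Z3 := filter_from [set: nat] (z3_ball x).

HB.instance Definition _ := hasNbhs.Build Z3 z3_nbhs.

Lemma z3_ball_center (x : Z3) n : z3_ball x n x.
Proof. by exists 0 => //; rewrite mulr0 subrr. Qed.

Lemma z3_ball_le (x : Z3) m n : (m <= n)%N -> z3_ball x n `<=` z3_ball x m.
Proof.
move=> lemn y [z _ yx]; exists ((3 ^ (n - m))%:R * z) => //.
by rewrite mulrA -natrM -expnD subnKC.
Qed.

Lemma z3_ball_trans (x y z : Z3) n : z3_ball x n y -> z3_ball y n z -> z3_ball x n z.
Proof.
move=> [u _ yx] [v _ zy]; exists (v + u) => //.
by rewrite mulrDr yx zy addrA subrK.
Qed.

Lemma z3_nbhs_filter (x : Z3) : ProperFilter (nbhs x).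
Proof.
apply: filter_from_proper => [|n _]; last by exists x; exact: z3_ball_center.
apply: filter_from_filter; first by exists 0%N.
move=> m n _ _; exists (maxn m n) => // y yx.
by split; apply: z3_ball_le yx; rewrite ?leq_maxl ?leq_maxr.
Qed.

Lemma z3_nbhs_singleton (x : Z3) (A : set Z3) : nbhs x A -> A x.
Proof. by move=> [n _]; apply; exact: z3_ball_center. Qed.

Lemma z3_nbhs_nbhs (x : Z3) (A : set Z3) : nbhs x A -> nbhs x (nbhs^~ A).
Proof.
move=> [n _ xA]; exists n => // y yx; exists n => // z zy.
exact/xA/(z3_ball_trans yx).
Qed.

HB.instance Definition _ :=
  Nbhs_isNbhsTopological.Build Z3 z3_nbhs_filter z3_nbhs_singleton z3_nbhs_nbhs.

Definition minimal_system (T : topologicalType) (g : T -> T) : Prop :=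
  forall x, dense [set iter n g x | n in [set: nat]].

(* Main.v *)
Require Import Defs.
From HB Require Import structures.
From mathcomp Require Import all_boot all_order all_algebra.
From mathcomp Require Import all_classical topology_structure.
From mathcomp Require Import ring zify.

(* A minimal f satisfies f(1) = -1 + 3p and f(-1) = 3q, so f^3 maps 3Z_3 to
   itself, and expanding f to second order at 0, 1, -1 gives
   f^3(3t) = 3(al + be t + 3 ga t^2) modulo 27.  With a, b, c the derivatives
   and a2, b2, c2 the second Taylor coefficients of f at 0, 1, -1, one has
   modulo 3: al = q + c p, be = a b c,
   ga = c b a2 + c b2 a^2 + c2 a^2 b^2.
   If be = 1 modulo 3 then f^9(3t) = 3t + 9(al + 2 ga al^2) modulo 27.
   Minimality amounts to f^(3^n)(x) - x having valuation exactly n for all x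
   and n, which reduces to n <= 2 by a first-order Taylor expansion; hence f is
   minimal iff be = 1, al <> 0 and al <> ga modulo 3.  These conditions depend
   on finitely many elements of F_3 only and are compared with the four cases of
   the theorem by enumeration. *)

Set Implicit Arguments.
Unset Strict Implicit.
Unset Printing Implicit Defensive.

Import GRing.Theory Num.Theory.
Local Open Scope ring_scope.

(** * Reduction modulo 3 and division by powers of 3 *)

Definition z3_mod3 (x : Z3) : 'F_3 := (x 1)%:~R.

Lemma F3_modz (m : int) : (m %% 3)%Z%:~R = m%:~R :> 'F_3.
Proof.
rewrite [in RHS](divz_eq m 3) [in RHS]intrD intrM.
by rewrite (_ : 3%:~R = 0 :> 'F_3) ?mulr0 ?add0r //; apply/eqP.
Qed.

Lemma z3_mod3_is_zmod_morphism : zmod_morphism z3_mod3.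
Proof.
by move=> x y; rewrite /z3_mod3 /= expr1 F3_modz intrD F3_modz intrN.
Qed.

Lemma z3_mod3_is_monoid_morphism : monoid_morphism z3_mod3.
Proof. by split=> [|x y]; rewrite /z3_mod3 /= expr1 F3_modz // intrM. Qed.

HB.instance Definition _ :=
  GRing.isZmodMorphism.Build Z3 'F_3 z3_mod3 z3_mod3_is_zmod_morphism.
HB.instance Definition _ :=
  GRing.isMonoidMorphism.Build Z3 'F_3 z3_mod3 z3_mod3_is_monoid_morphism.

Lemma F3_cases (x : 'F_3) : [\/ x = 0, x = 1 | x = -1].
Proof.
case: x => [[|[|[|//]]]] lt_x3; [apply: Or31|apply: Or32|apply: Or33];
  exact/val_inj.
Qed.

Lemma z3_res_natr_mul (m : nat) (x : Z3) n :
  (m%:R * x) n = ((m%:Z * x n) %% 3 ^+ n)%Z.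
Proof.
rewrite mulr_natl; elim: m => [|m IHm].
  by rewrite mulr0n mul0r mod0z /= mod0z.
by rewrite mulrS /= IHm modzDmr intS mulrDl mul1r.
Qed.

(** If 3 x = 0, then 3^(n+1) divides 3 times component n + 1 of x, so 3^n divides that component,
    and component n vanishes. *)
Lemma z3_mul3I : injective (fun x : Z3 => 3 * x).
Proof.
suff z3_mul3_eq0 (x : Z3) : 3 * x = 0 -> x = 0.
  by move=> x y /eqP; rewrite -subr_eq0 -mulrBr => /eqP/z3_mul3_eq0/subr0_eq.
move=> x30; apply: z3_eqP => n.
have := congr1 (fun y : Z3 => y n.+1) x30.
have z3_res0 m : (0 : Z3) m = 0 by exact: mod0z.
rewrite !z3_res0 z3_res_natr_mul exprS => /dvdz_mod0P.
by rewrite dvdz_mul2l // => /dvdz_mod0P; rewrite -z3resP.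
Qed.

Lemma z3_mod3_eq0 (x : Z3) : z3_mod3 x = 0 -> exists y, x = 3 * y.
Proof.
move=> x0; have x1 : x 1 = 0.
  have := z3res_small x 1; have := modz_ge0 (x 1) (isT : (3 != 0 :> int)).
  have := ltz_pmod (x 1) (isT : (0 < 3 :> int)); rewrite expr1.
  move: x0; rewrite /z3_mod3 -F3_modz; case: (_ %% _)%Z => [|//].
  by case=> [|[|[|]]] // x0 _ _ <-.
have dvd3x n : exists k, x n.+1 = 3 * k.
  elim: n => [|n [k xn]]; first by exists 0.
  have := divz_eq (x n.+2) (3 ^+ n.+1); rewrite -z3resP xn exprS => ->.
  by exists ((x n.+2 %/ (3 * 3 ^+ n))%Z * 3 ^+ n + k); ring.
(* Dividing by 3 loses one digit, so component n of the quotient is read off component n + 1 of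
   x. *)
have yP n : (x n.+1 %/ 3)%Z = ((x n.+2 %/ 3)%Z %% 3 ^+ n)%Z.
  rewrite z3resP; have [k ->] := dvd3x n.+1.
  by rewrite exprS -mulz_modr // !mulKz.
exists (MkZ3 yP); apply: z3_eqP => n.
rewrite z3_res_natr_mul /=; have [k xk] := dvd3x n.
by rewrite [in RHS]xk mulKz // -[in RHS]xk -z3resP.
Qed.

Lemma z3_mod3_3M (x : Z3) : z3_mod3 (3 * x) = 0.
Proof. by rewrite rmorphM rmorph_nat (_ : 3%:R = 0) ?mul0r //; apply/eqP. Qed.

Lemma z3_pow3_mulI n : injective (fun x : Z3 => 3 ^+ n * x).
Proof.
elim: n => [|n IHn] x y; first by rewrite !mul1r.
by rewrite exprS -!mulrA => /z3_mul3I/IHn.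
Qed.

(** Induction on n: u is nonzero in the field F_3, so a factor 3 of h u must come from h and can be
    cancelled. *)
Lemma z3_pow3_mul_unit (u h e : Z3) n :
    z3_mod3 u != 0 -> h * u = 3 ^+ n * e ->
  exists2 e', h = 3 ^+ n * e' & e' * u = e.
Proof.
move=> u0; elim: n h e => [|n IHn] h e.
  by rewrite mul1r => <-; exists h; rewrite ?mul1r.
rewrite exprS -mulrA => hu.
have /z3_mod3_eq0[h' defh] : z3_mod3 h = 0.
  have /eqP := congr1 z3_mod3 hu.
  rewrite rmorphM z3_mod3_3M mulf_eq0 (negPf u0) orbF.
  by move/eqP.
have /IHn[e' defh' eu] : h' * u = 3 ^+ n * e.
  by apply: z3_mul3I; rewrite mulrA -defh.
by exists e' => //; rewrite defh defh' mulrA.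
Qed.

(** * Taylor expansions of polynomial maps *)

Lemma horner_taylor3 (R : comNzRingType) (f : {poly R}) (x h : R) : exists r,
  f.[x + h] = f.[x] + f^`().[x] * h + f^`N(2).[x] * h ^+ 2 + r * h ^+ 3.
Proof.
have le_f : (size f <= (size f).+3)%N by rewrite !leqW.
rewrite (nderiv_taylor_wide (mulrC x h) le_f) !big_ord_recl /=.
exists (\sum_(i < size f) f^`N(i.+3).[x] * h ^+ i).
rewrite nderivn0 nderivn1 expr0 mulr1 expr1 !addrA mulr_suml; congr (_ + _).
by apply: eq_bigr => i _ /=; rewrite -mulrA -exprD addn3.
Qed.

Lemma horner_taylor2 (R : comNzRingType) (f : {poly R}) (x h : R) : exists r,
  f.[x + h] = f.[x] + f^`().[x] * h + r * h ^+ 2.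
Proof.
have [r ->] := horner_taylor3 f x h; exists (f^`N(2).[x] + r * h); ring.
Qed.

Lemma z3_mod3_horner (f : {poly Z3}) x :
  z3_mod3 f.[x] = (map_poly z3_mod3 f).[z3_mod3 x].
Proof. by rewrite horner_map. Qed.

Lemma z3_mod3_cong (f : {poly Z3}) x y :
  z3_mod3 x = z3_mod3 y -> z3_mod3 f.[x] = z3_mod3 f.[y].
Proof. by rewrite !z3_mod3_horner => ->. Qed.

(** * Minimality in terms of orbits modulo 3^n *)

Lemma z3_ballP (x y : Z3) n : z3_ball y n x <-> exists z, x = y + 3 ^+ n * z.
Proof.
split=> [[z _ xy]|[z ->]]; exists z => //.
  by rewrite -natrX xy addrC subrK.
by rewrite natrX [RHS]addrC addKr.
Qed.

(** Balls are open and form a basis of neighbourhoods, so density need only be tested on balls. *)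
Lemma minimal_systemP (g : Z3 -> Z3) :
  minimal_system g <-> forall x y n, exists k z, iter k g x = y + 3 ^+ n * z.
Proof.
split=> [g_min x y n|g_orb x O [y Oy] O_open].
  have O_open : open (z3_ball y n).
    rewrite openE => z yz; exists n => // t zt; exact: z3_ball_trans yz zt.
  have [|z [yz [k _ kz]]] := g_min x (z3_ball y n) _ O_open.
    by exists y; exact: z3_ball_center.
  by exists k; rewrite kz; apply/z3_ballP.
have [n _ ynO] : nbhs y O by move: O_open; rewrite openE; apply.
have [k kz] := g_orb x y n; exists (iter k g x); split; last by exists k.
exact/ynO/z3_ballP.
Qed.

Lemma iter_horner_cong (f : {poly Z3}) m (c x z : Z3) :
  exists z', iter m (horner f) (x + c * z) = iter m (horner f) x + c * z'.
Proof.
elim: m => [|m [z' /= ->]] /=; first by exists z.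
have [r ->] := horner_taylor2 f (iter m (horner f) x) (c * z').
exists (f^`().[iter m (horner f) x] * z' + r * c * z' ^+ 2); ring.
Qed.

Lemma z3_res_cong (x z : Z3) n : (x + 3 ^+ n * z) n = x n.
Proof.
have w0 : (3 ^+ n * z : Z3) n = 0.
  by rewrite -natrX z3_res_natr_mul -natz natrX modzMr.
have -> : (x + 3 ^+ n * z) n = ((x n + (3 ^+ n * z : Z3) n) %% 3 ^+ n)%Z by [].
by rewrite w0 addr0 z3res_small.
Qed.

(** A return modulo 3^n after m steps makes the orbit periodic modulo 3^n, so it meets at most m
    residues, whereas a dense orbit meets all 3^n of them. *)
Lemma minimal_period_ge (f : {poly Z3}) x z m n :
  minimal_system (horner f) -> (0 < m)%N ->
  iter m (horner f) x = x + 3 ^+ n * z -> (3 ^ n <= m)%N.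
Proof.
move=> /minimal_systemP f_min m_gt0 fmx.
have period q : exists z', iter (m * q) (horner f) x = x + 3 ^+ n * z'.
  elim: q => [|q [z' IHq]]; first by exists 0; rewrite muln0 mulr0 addr0.
  have [z'' fz'] := iter_horner_cong f m (3 ^+ n) x z'.
  by exists (z + z''); rewrite mulnS iterD IHq fz' fmx mulrDr addrA.
pose s := [seq (iter i (horner f) x) n | i <- iota 0 m].
pose t := [seq i%:Z | i <- iota 0 (3 ^ n)].
have t_uniq : uniq t by rewrite map_inj_uniq ?iota_uniq // => i j [].
have sub_ts : {subset t <= s}.
  move=> j /mapP[i]; rewrite mem_iota /= => lt_i ->.
  have [k [y fky]] := f_min x (z3_of_int i) n.
  (* By periodicity only the remainder of the time k modulo m matters. *)
  apply/mapP; exists (k %% m)%N; first by rewrite mem_iota ltn_mod m_gt0.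
  have [z' fq] := period (k %/ m)%N.
  have [z'' fr] := iter_horner_cong f (k %% m) (3 ^+ n) x z'.
  have := z3_res_cong (iter (k %% m) (horner f) x) z'' n.
  rewrite -fr -fq -iterD addnC mulnC -divn_eq fky z3_res_cong /=.
  by move=> <-; rewrite -natrX natz modz_nat modn_small.
by have := uniq_leq_size t_uniq sub_ts; rewrite !size_map !size_iota.
Qed.

(** * Expansions of f^3 and f^9 on 3Z_3 *)

Lemma return_map_expansion (f : {poly Z3}) (p q : Z3) :
    f.[0] = 1 -> f.[1] = -1 + 3 * p -> f.[-1] = 3 * q ->
  let a := f^`().[0] in let b := f^`().[1] in let c := f^`().[-1] in
  let a2 := f^`N(2).[0] in let b2 := f^`N(2).[1] in let c2 := f^`N(2).[-1] in
  forall t, exists r, iter 3 (horner f) (3 * t) =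
    3 * (q + c * p + 3 * c2 * p ^+ 2 + (a * b * c + 6 * c2 * p * a * b) * t +
      3 * (c * b * a2 + c * b2 * a ^+ 2 + c2 * a ^+ 2 * b ^+ 2) * t ^+ 2 + 9 * r).
Proof.
move=> f0 f1 f2 a b c a2 b2 c2 t /=.
have [r1] := horner_taylor3 f 0 (3 * t); rewrite add0r f0 -/a -/a2 => ->.
(* The orbit of 3t runs near 0, 1, -1, 0: here f(3t) = 1 + 3s, and below f(1 + 3s) = -1 + 3w. *)
set s := a * t + 3 * a2 * t ^+ 2 + 9 * (r1 * t ^+ 3).
rewrite (_ : 1 + _ + _ + _ = 1 + 3 * s); last by rewrite /s; ring.
have [r2] := horner_taylor3 f 1 (3 * s); rewrite f1 -/b -/b2 => ->.
set w := p + b * s + 3 * b2 * s ^+ 2 + 9 * (r2 * s ^+ 3).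
rewrite (_ : -1 + _ + _ + _ + _ = -1 + 3 * w); last by rewrite /w; ring.
have [r3] := horner_taylor3 f (-1) (3 * w); rewrite f2 -/c -/c2 => ->.
(* Squares always occur with a factor 9, so modulo 27 only s^2 and w^2 modulo 3 matter; [s2] and
   [w2] record the discarded multiples of 3. *)
pose s2 := 2 * a * t * (a2 * t ^+ 2 + 3 * r1 * t ^+ 3) +
  3 * (a2 * t ^+ 2 + 3 * r1 * t ^+ 3) ^+ 2.
have ws : s ^+ 2 = (a * t) ^+ 2 + 3 * s2 by rewrite /s /s2; ring.
pose w1 := b * r1 * t ^+ 3 + b2 * s2 + r2 * s ^+ 3.
have defw : w = p + b * a * t + 3 * (b * a2 + b2 * a ^+ 2) * t ^+ 2 + 9 * w1.
  by rewrite /w ws /w1 {1}/s; ring.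
pose w0 := (b * a2 + b2 * a ^+ 2) * t ^+ 2 + 3 * w1.
pose w2 := 2 * (p + b * a * t) * w0 + 3 * w0 ^+ 2.
have ww : w ^+ 2 = (p + b * a * t) ^+ 2 + 3 * w2 by rewrite defw /w2 /w0; ring.
exists (c * w1 + c2 * w2 + r3 * w ^+ 3).
rewrite (_ : 3 * q + _ + _ + _ =
  3 * (q + c * w + 3 * c2 * w ^+ 2 + 9 * (r3 * w ^+ 3))); last by ring.
by rewrite ww {1}defw; ring.
Qed.

(** Modulo 3 the three arguments are t, t + al, t + 2 al. Their sum is divisible by 3, so de drops
    out modulo 9; the sum of their squares is 3 t^2 + 6 t al + 5 al^2, which leaves 2 al^2 modulo
    3. *)
Lemma iter_return_map (F : Z3 -> Z3) (al de ga : Z3) :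
    (forall t, exists r, F (3 * t) =
      3 * (al + (1 + 3 * de) * t + 3 * ga * t ^+ 2 + 9 * r)) ->
  forall t, exists r, iter 3 F (3 * t) =
    3 * (t + 3 * (al + 2 * ga * al ^+ 2) + 9 * r).
Proof.
move=> FE t /=; have [r1 ->] := FE t; set t1 := al + _ + _ + _.
have [r2 ->] := FE t1; set t2 := al + _ + _ + _.
have [r3 ->] := FE t2.
pose w1 := de * t + ga * t ^+ 2 + 3 * r1.
pose w2 := w1 + de * t1 + ga * t1 ^+ 2 + 3 * r2.
have t1E : t1 = al + t + 3 * w1 by rewrite /t1 /w1; ring.
have t2E : t2 = 2 * al + t + 3 * w2.
  rewrite (_ : t2 = t1 + (al + 3 * (de * t1 + ga * t1 ^+ 2 + 3 * r2))).
    by rewrite {1}t1E /w2; ring.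
  by rewrite /t2; ring.
pose k1 := 2 * (al + t) * w1 + 3 * w1 ^+ 2.
pose k2 := 2 * (2 * al + t) * w2 + 3 * w2 ^+ 2.
have t1s : t1 ^+ 2 = (al + t) ^+ 2 + 3 * k1 by rewrite t1E /k1; ring.
have t2s : t2 ^+ 2 = (2 * al + t) ^+ 2 + 3 * k2 by rewrite t2E /k2; ring.
exists (al * (de + de ^+ 2) + t * (de + 3 * de ^+ 2 + 3 * de ^+ 3) +
  ga * ((2 * de + 3 * de ^+ 2) * t ^+ 2 + de * (al + t) ^+ 2 +
        (1 + 3 * de) * k1 + k2 + (t + al) ^+ 2) +
  (1 + 3 * de) ^+ 2 * r1 + (1 + 3 * de) * r2 + r3).
by rewrite t2s {1}/t2 t1s {1}/t1; ring.
Qed.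

(** * The iterates f^(3^n) as polynomials, and the valuation of their displacement *)

Fixpoint iter3_poly (f : {poly Z3}) n : {poly Z3} :=
  if n is n'.+1 then
    let g := iter3_poly f n' in g \Po (g \Po g)
  else f.

Lemma iter3_polyS f n :
  iter3_poly f n.+1 = iter3_poly f n \Po (iter3_poly f n \Po iter3_poly f n).
Proof. by []. Qed.

Lemma horner_iter3_poly f n x :
  (iter3_poly f n).[x] = iter (3 ^ n) (horner f) x.
Proof.
elim: n x => [|n IHn] x //=.
by rewrite !horner_comp !IHn -!iterD expnS !mulSn addn0 addnA.
Qed.

Lemma mod3_iter3_poly f n x :
    (forall y, z3_mod3 f.[y] = z3_mod3 y + 1) -> (0 < n)%N ->
  z3_mod3 (iter3_poly f n).[x] = z3_mod3 x.
Proof.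
move=> f_succ; case: n => // n _; elim: n x => [|n IHn] x.
  rewrite /= !horner_comp !f_succ -!addrA (_ : 1 + (1 + 1) = 0) ?addr0 //.
  exact/eqP.
rewrite (iter3_polyS f n.+1); move: (iter3_poly f n.+1) IHn => g IHn.
by rewrite !horner_comp !IHn.
Qed.

(** By the chain rule the derivative of f^3 at x is modulo 3 the product of f' over 0, 1, -1, in an
    order depending on x. Higher iterates only multiply factors equal to 1. *)
Lemma mod3_deriv_iter3_poly f n x :
    (forall y, z3_mod3 f.[y] = z3_mod3 y + 1) ->
    z3_mod3 (f^`().[0] * f^`().[1] * f^`().[-1]) = 1 -> (0 < n)%N ->
  z3_mod3 (iter3_poly f n)^`().[x] = 1.
Proof.
move=> f_succ abc1; case: n => // n _; elim: n x => [|n IHn] x.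
  rewrite /= !deriv_comp !hornerM !horner_comp !rmorphM.
  set F := map_poly z3_mod3 f^`().
  have FE y : z3_mod3 f^`().[y] = F.[z3_mod3 y] by rewrite -horner_map.
  move: abc1; rewrite !rmorphM /= !FE !f_succ rmorphN rmorph0 rmorph1.
  rewrite (_ : -1 = 1 + 1 :> 'F_3); last exact/eqP.
  move=> abc1; have [->|->|->] := F3_cases (z3_mod3 x).
  - by rewrite add0r -[RHS]abc1; ring.
  - by rewrite (_ : 1 + 1 + 1 = 0 :> 'F_3); [rewrite -[RHS]abc1; ring | exact/eqP].
  - rewrite (_ : -1 + 1 = 0 :> 'F_3); last exact/eqP.
    rewrite (_ : -1 = 1 + 1 :> 'F_3); last exact/eqP.
    by rewrite add0r -[RHS]abc1; ring.
rewrite (iter3_polyS f n.+1); move: (iter3_poly f n.+1) IHn => g IHn.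
by rewrite !deriv_comp !hornerM !horner_comp !rmorphM /= !IHn !mulr1.
Qed.

Lemma z3_mod3_eq (x y : Z3) : z3_mod3 x = z3_mod3 y -> exists z, x = y + 3 * z.
Proof.
move=> xy; have [|z defz] := @z3_mod3_eq0 (x - y).
  by rewrite rmorphB /= xy subrr.
by exists z; rewrite -defz addrC subrK.
Qed.

(** This says that f^(3^n)(x) - x has valuation exactly n. *)
Definition unit_shift (f : {poly Z3}) n x :=
  exists2 e, z3_mod3 e != 0 & (iter3_poly f n).[x] = x + 3 ^+ n * e.

(** The iterate f^(3^n) commutes with f, and f preserves the valuation of a difference of the form
    3h at x because f'(x) is a unit. *)
Lemma unit_shift_preim (f : {poly Z3}) n x :
    (forall y, z3_mod3 f.[y] = z3_mod3 y + 1) -> (0 < n)%N ->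
    z3_mod3 f^`().[x] != 0 ->
  unit_shift f n f.[x] -> unit_shift f n x.
Proof.
move=> f_succ n_gt0 f'x [e e0 fe].
have [h gx] := z3_mod3_eq (mod3_iter3_poly x f_succ n_gt0).
have [r fxh] := horner_taylor2 f x (3 * h).
(* Here f(x + 3h) - f(x) = 3h (f'(x) + 3 r h), and the second factor is a unit. *)
have [||e' defh eu] := @z3_pow3_mul_unit (f^`().[x] + 3 * (r * h)) (3 * h) e n.
- by rewrite rmorphD /= z3_mod3_3M addr0.
- apply: (addrI f.[x]); rewrite -fe.
  have -> : (iter3_poly f n).[f.[x]] = f.[(iter3_poly f n).[x]].
    by rewrite !horner_iter3_poly -iterSr.
  by rewrite gx fxh; ring.
exists e'; last by rewrite gx defh.
by apply: contraNneq e0; rewrite -eu rmorphM /= => ->; rewrite mul0r.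
Qed.

(** With g' = 1 + 3c at x, the three displacements are e, e + 3ce and e + 6ce times 3^(n+2), up to
    multiples of 3^(n+4), and the c-terms add up to 9ce. The exponent n + 2 is at least 2, which is
    what makes the quadratic Taylor terms divisible by 3^(n+4). *)
Lemma unit_shift_triple (g : {poly Z3}) n :
    (forall x, z3_mod3 g^`().[x] = 1) ->
    (forall x, exists2 e, z3_mod3 e != 0 & g.[x] = x + 3 ^+ n.+2 * e) ->
  forall x, exists2 e, z3_mod3 e != 0 & g.[g.[g.[x]]] = x + 3 ^+ n.+3 * e.
Proof.
move=> g'1 gE x; have [e e0 gx] := gE x.
have [|c g'x] := @z3_mod3_eq g^`().[x] 1; first by rewrite g'1 rmorph1.
move: gx; rewrite !exprS; set P := 3 ^+ n => gx.
rewrite [g.[x]]gx.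
have [r1 ->] := horner_taylor2 g x (3 * (3 * P) * e).
pose k := c * e + 3 * P * r1 * e ^+ 2.
rewrite gx g'x (_ : _ + _ + _ = x + 9 * P * (2 * e + 3 * k)); last first.
  by rewrite /k; ring.
have [r2 ->] := horner_taylor2 g x (9 * P * (2 * e + 3 * k)).
exists (e + 3 * (c * e + P * r1 * e ^+ 2 + c * k + P * r2 * (2 * e + 3 * k) ^+ 2)).
  by rewrite rmorphD /= z3_mod3_3M addr0.
rewrite gx g'x.
rewrite (_ : _ + _ + _ = x + 9 * P * (3 * e + 3 * k + 6 * c * e + 9 * c * k
   + 9 * P * r2 * (2 * e + 3 * k) ^+ 2)); last by ring.
by rewrite {1}/k; ring.
Qed.

Lemma F3_unit_sum (e1 e2 e3 : 'F_3) :
  e1 != 0 -> e2 != 0 -> e3 != 0 -> e1 + e2 + e3 = 0 -> e2 = e1.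
Proof.
by have [->|->|->] := F3_cases e1; have [->|->|->] := F3_cases e2;
   have [->|->|->] := F3_cases e3.
Qed.

Lemma F3_multiple (e r : 'F_3) : e != 0 -> [\/ r = 0, r = e | r = e + e].
Proof.
by have [->|->|->] := F3_cases e; have [->|->|->] := F3_cases r => // _;
  first [by apply: Or31 | by apply: Or32; apply/eqP | by apply: Or33; apply/eqP].
Qed.

(** Induction on n: once the orbit meets y modulo 3^n, applying f^(3^n) zero, one or two times
    reaches all three lifts of that class modulo 3^(n+1). *)
Lemma unit_shift_minimal (f : {poly Z3}) :
  (forall n x, unit_shift f n x) -> minimal_system (horner f).
Proof.
move=> f_shift; apply/minimal_systemP => x y n.
elim: n => [|n [k [z fkx]]].
  by exists 0, (x - y); rewrite mul1r addrC subrK.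
set x1 := iter k (horner f) x in fkx.
have [e1 e1_0 g1] := f_shift n x1; set x2 := x1 + _ in g1.
have [e2 e2_0 g2] := f_shift n x2; set x3 := x2 + _ in g2.
have [e3 e3_0 g3] := f_shift n x3.
(* Three applications of f^(3^n) give f^(3^(n+1)), whose shift is divisible by 3^(n+1); so e1 + e2 +
   e3 = 0 modulo 3, and units of F_3 with sum 0 are equal. *)
have [e _] := f_shift n.+1 x1.
rewrite iter3_polyS !horner_comp g1 g2 g3 => sum_e.
have {}sum_e : e1 + e2 + e3 = 3 * e.
  apply: (@z3_pow3_mulI n); apply: (addrI x1).
  transitivity (x3 + 3 ^+ n * e3); first by rewrite /x3 /x2 !mulrDr !addrA.
  by rewrite sum_e exprS mulrA [_ * 3]mulrC.
have e21 : z3_mod3 e2 = z3_mod3 e1.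
  by apply: F3_unit_sum e3_0 _ => //; rewrite -!rmorphD /= sum_e z3_mod3_3M.
rewrite horner_iter3_poly in g1; rewrite horner_iter3_poly in g2.
have close (j : nat) w : iter j (horner f) x1 = x1 + 3 ^+ n * w ->
    z3_mod3 (- z) = z3_mod3 w ->
  exists k' z', iter k' (horner f) x = y + 3 ^+ n.+1 * z'.
  move=> fj zw; have [v defw] := z3_mod3_eq (esym zw).
  exists (j + k)%N, v; rewrite iterD -/x1 fj defw fkx exprS; ring.
have [z0|z1|z2] := F3_multiple (z3_mod3 (- z)) e1_0.
- by apply: (close 0%N 0); rewrite ?rmorph0 //= mulr0 addr0.
- exact: close g1 z1.
- apply: (close (3 ^ n + 3 ^ n)%N (e1 + e2)).
    by rewrite iterD g1 -/x2 g2 /x3 /x2 mulrDr addrA.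
  by rewrite rmorphD /= e21.
Qed.

(** * The minimality criterion modulo 3 *)

Lemma F3_sqr (x : 'F_3) : x != 0 -> x ^+ 2 = 1.
Proof. by have [->|->|->] := F3_cases x => // _; apply/eqP. Qed.

(** If be <> 1, then al / (1 - be) is a fixed point. *)
Lemma F3_no_fixpoint (al be : 'F_3) :
  (forall t, al + be * t != t) -> be = 1 /\ al != 0.
Proof.
move=> no_fix; move: (no_fix 0) (no_fix 1) (no_fix (-1)).
by have [->|->|->] := F3_cases al; have [->|->|->] := F3_cases be => // ;
   split=> //; apply/eqP.
Qed.

Lemma minimal_criterion (f : {poly Z3}) (p q : Z3) :
    f.[0] = 1 -> f.[1] = -1 + 3 * p -> f.[-1] = 3 * q ->
  let a := f^`().[0] in let b := f^`().[1] in let c := f^`().[-1] in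
  let a2 := f^`N(2).[0] in let b2 := f^`N(2).[1] in let c2 := f^`N(2).[-1] in
  minimal_system (horner f) <->
  [/\ z3_mod3 (a * b * c) = 1, z3_mod3 (q + c * p) != 0 &
      z3_mod3 (q + c * p) !=
      z3_mod3 (c * b * a2 + c * b2 * a ^+ 2 + c2 * a ^+ 2 * b ^+ 2)].
Proof.
move=> f0 f1 f2 a b c a2 b2 c2.
have f3E := return_map_expansion f0 f1 f2; cbv zeta in f3E.
rewrite -/a -/b -/c -/a2 -/b2 -/c2 in f3E.
set al := q + _ + _ in f3E; set be := a * b * c + _ in f3E.
set ga := c * b * a2 + _ + _; rewrite -/ga in f3E.
(* The expansion coefficients [al] and [be] differ from q + c p and a b c by multiples of 3. *)
have -> : z3_mod3 (q + c * p) = z3_mod3 al.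
  by rewrite /al [in RHS]rmorphD -!mulrA /= z3_mod3_3M addr0.
have abcE : z3_mod3 (a * b * c) = z3_mod3 be.
  rewrite /be [in RHS]rmorphD (_ : 6 * _ * _ * _ * _ = 3 * (2 * c2 * p * a * b)).
    by rewrite /= z3_mod3_3M addr0.
  by ring.
rewrite abcE; have f3_mod3 t : exists2 u, iter 3 (horner f) (3 * t) = 3 * u &
    z3_mod3 u = z3_mod3 al + z3_mod3 be * z3_mod3 t.
  have [r f3t] := f3E t; exists (al + be * t + 3 * ga * t ^+ 2 + 9 * r) => //.
  rewrite (_ : _ + _ = al + be * t + 3 * (ga * t ^+ 2 + 3 * r)); last by ring.
  by rewrite !(rmorphD, rmorphM z3_mod3 be) /= z3_mod3_3M addr0.
have f9E : z3_mod3 be = 1 -> forall t, exists r, iter 9 (horner f) (3 * t) =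
    3 * (t + 3 * (al + 2 * ga * al ^+ 2) + 9 * r).
  move=> be1 t; have [|de deE] := @z3_mod3_eq be 1; first by rewrite be1 rmorph1.
  by apply: (@iter_return_map (iter 3 (horner f)) al de ga) => u; rewrite -deE.
have ga_al : z3_mod3 al != 0 ->
    z3_mod3 (al + 2 * ga * al ^+ 2) = z3_mod3 al - z3_mod3 ga.
  move=> al0; rewrite expr2 rmorphD !rmorphM /= -expr2 F3_sqr // mulr1.
  by rewrite rmorph_nat (_ : 2 = -1) ?mulN1r //; apply/eqP.
split=> [f_min|[be1 al0 al_ga]].
  have [t|be1 al0] := @F3_no_fixpoint (z3_mod3 al) (z3_mod3 be).
    (* A fixed residue t of the affine map lifts to a point 3u with f^3(3u) = 3u modulo 9, a return
       that is too early. *)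
    apply/eqP => fix_t; pose u : Z3 := (t : nat)%:R.
    have ut : z3_mod3 u = t by rewrite /u rmorph_nat natr_Zp.
    have [v f3u] := f3_mod3 u; rewrite ut fix_t -ut => /z3_mod3_eq[z vE].
    have //: (3 ^ 2 <= 3)%N.
    by apply: (@minimal_period_ge f (3 * u) z) => //; rewrite f3u vE; ring.
  (* If al = ga modulo 3, then al + 2 ga al^2 vanishes modulo 3 and f^9 fixes 0 modulo 27. *)
  split=> //; apply/eqP => al_ga; have [r f9] := f9E be1 0.
  have [|w wE] := @z3_mod3_eq0 (al + 2 * ga * al ^+ 2).
    by rewrite ga_al // al_ga subrr.
  have //: (3 ^ 3 <= 9)%N.
  by apply: (@minimal_period_ge f (3 * 0) (w + r)) => //; rewrite f9 wE; ring.
have f_succ y : z3_mod3 f.[y] = z3_mod3 y + 1.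
  have [y0|y1|y2] := F3_cases (z3_mod3 y).
  - by rewrite (@z3_mod3_cong f y 0) ?rmorph0 // f0 y0 add0r rmorph1.
  - rewrite (@z3_mod3_cong f y 1) ?rmorph1 // f1 y1 rmorphD /= z3_mod3_3M.
    by rewrite rmorphN rmorph1; apply/eqP.
  - rewrite (@z3_mod3_cong f y (-1)) ?rmorphN1 // f2 y2 z3_mod3_3M.
    by rewrite addNr.
have abc1 : z3_mod3 (a * b * c) = 1 by rewrite abcE.
have f'_unit x : z3_mod3 f^`().[x] != 0.
  have : z3_mod3 a * z3_mod3 b * z3_mod3 c != 0 by rewrite -!rmorphM /= abc1.
  rewrite !mulf_eq0 !negb_or => /andP[/andP[a0 b0] c0].
  have [x0|x1|x2] := F3_cases (z3_mod3 x).
  - by rewrite (@z3_mod3_cong _ x 0) ?rmorph0.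
  - by rewrite (@z3_mod3_cong _ x 1) ?rmorph1.
  - by rewrite (@z3_mod3_cong _ x (-1)) ?rmorphN1.
(* Every residue class reaches 0 within two steps of f, so the property pulls back from 3Z_3 to all
   of Z_3. *)
have shift_lift n : (0 < n)%N -> (forall t, unit_shift f n (3 * t)) ->
    forall x, unit_shift f n x.
  move=> n_gt0 shift0 x.
  have shift_0 y : z3_mod3 y = 0 -> unit_shift f n y.
    by move/z3_mod3_eq0 => [t ->].
  have [x0|x1|x2] := F3_cases (z3_mod3 x); first exact: shift_0.
    apply: unit_shift_preim => //; apply: unit_shift_preim => //.
    by apply: shift_0; rewrite !f_succ x1; apply/eqP.
  apply: unit_shift_preim => //; apply: shift_0.
  by rewrite f_succ x2 addNr.
have shift2 : forall x, unit_shift f 2 x.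
  apply: shift_lift => // t; have [r f9] := f9E be1 t.
  exists (al + 2 * ga * al ^+ 2 + 3 * r).
    by rewrite rmorphD /= z3_mod3_3M addr0 ga_al // subr_eq0.
  by rewrite horner_iter3_poly f9; ring.
apply: unit_shift_minimal => -[|[|n]].
- move=> x; exists (f.[x] - x); last by rewrite mul1r addrC subrK.
  by rewrite rmorphB /= f_succ addrC addKr.
- apply: shift_lift => // t; have [u f3 uE] := f3_mod3 t.
  exists (u - t); last by rewrite horner_iter3_poly f3; ring.
  by rewrite rmorphB /= uE be1 mul1r addrK.
(* Tripling requires exponent at least 2, so the induction starts from [shift2]. *)
- elim: n => [|n IHn] // x; rewrite /unit_shift (iter3_polyS f n.+2).
  have g'1 y : z3_mod3 (iter3_poly f n.+2)^`().[y] = 1.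
    exact: mod3_deriv_iter3_poly.
  rewrite /unit_shift in IHn.
  move: (iter3_poly f n.+2) IHn g'1 => g IHn g'1.
  have [e e0 ge] := unit_shift_triple g'1 IHn x.
  by exists e => //; rewrite !horner_comp.
Qed.

(** * Congruences modulo 3 and 9, and the residue cycle of a minimal f *)

Lemma z3_cong3E (x y : Z3) : z3_cong 3 x y <-> z3_mod3 x == z3_mod3 y.
Proof.
split=> [[z _ xy]|/eqP/z3_mod3_eq[z ->]].
  by rewrite -(subrK y x) -xy rmorphD /= z3_mod3_3M add0r.
by exists z => //; rewrite addrC addKr.
Qed.

Lemma z3_cong9E (x y : Z3) : z3_cong 9 (3 * x) (3 * y) <-> z3_mod3 x == z3_mod3 y.
Proof.
rewrite -z3_cong3E; split=> -[z _ xy]; exists z => //.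
  by apply: z3_mul3I; rewrite mulrBr -xy; ring.
by rewrite -mulrBr -xy; ring.
Qed.

(** No residue modulo 3 may return within one or two steps, which with f(0) = 1 leaves only the
    cycle 0, 1, -1. *)
Lemma minimal_mod3 (f : {poly Z3}) : f.[0] = 1 -> minimal_system (horner f) ->
  z3_mod3 f.[1] = -1 /\ z3_mod3 f.[-1] = 0.
Proof.
move=> f0 f_min.
have no_return m x z : (0 < m < 3)%N -> iter m (horner f) x = x + 3 * z -> False.
  case/andP=> m_gt0 lt_m3 fmx.
  by have := @minimal_period_ge f x z m 1 f_min m_gt0 fmx; rewrite leqNgt lt_m3.
have f1 : z3_mod3 f.[1] = -1.
  have [f1|f1|//] := F3_cases (z3_mod3 f.[1]).
    have [z fz] := z3_mod3_eq0 f1; case: (@no_return 2 0 z isT).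
    by rewrite /= f0 fz add0r.
  have [|z fz] := @z3_mod3_eq f.[1] 1; first by rewrite f1 rmorph1.
  by case: (@no_return 1 1 z isT).
split=> //; have [//|f2|f2] := F3_cases (z3_mod3 f.[-1]).
  have [|z fz] := @z3_mod3_eq f.[-1] 1; first by rewrite f2 rmorph1.
  have [w /= fw] := iter_horner_cong f 1 3 1 z.
  have [|y fy] := @z3_mod3_eq f.[1] (-1); first by rewrite f1 rmorphN1.
  by case: (@no_return 2 (-1) (y + w) isT); rewrite /= fz fw fy; ring.
have [|z fz] := @z3_mod3_eq f.[-1] (-1); first by rewrite f2 rmorphN1.
by case: (@no_return 1 (-1) z isT).
Qed.

(** * Values and derivatives at 1 and -1 as coefficient sums *)

Lemma horner_sqr1 (R : comNzRingType) (g : {poly R}) (d : nat) (x : R) :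
    (size g <= d.+1)%N -> x ^+ 2 = 1 ->
  g.[x] = g`_0 + \sum_(2 <= i < d.+1 | ~~ odd i) g`_i +
          x * \sum_(1 <= i < d.+1 | odd i) g`_i.
Proof.
move=> le_g x2; have xE i : x ^+ i = if odd i then x else 1.
  by rewrite -[i in LHS]odd_double_half exprD -mul2n exprM x2 expr1n mulr1; case: odd.
rewrite (horner_coef_wide _ le_g) -(big_mkord xpredT (fun i => g`_i * x ^+ i)).
rewrite big_ltn // mulr1 -addrA; congr (_ + _).
rewrite (bigID odd) /= addrC; congr (_ + _).
  case: d {le_g} => [|d]; first by rewrite !big_geq.
  rewrite big_ltn_cond //=; apply: eq_bigr => i /negPf oddi.
  by rewrite xE oddi mulr1.
by rewrite mulr_sumr; apply: eq_bigr => i oddi; rewrite xE oddi mulrC.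
Qed.

Lemma horner_deriv_sqr1 (R : comNzRingType) (f : {poly R}) (d : nat) (x : R) :
    (size f <= d.+1)%N -> x ^+ 2 = 1 ->
  f^`().[x] = x * \sum_(2 <= i < d.+1 | ~~ odd i) i%:R * f`_i +
              \sum_(1 <= i < d.+1 | odd i) i%:R * f`_i.
Proof.
(* Multiplying f' by X undoes its index shift, and x^2 = 1 recovers f'(x) as x g(x). *)
move=> /leq_sizeP f_coef x2; pose g := 'X * f^`().
have gE i : g`_i = i%:R * f`_i.
  rewrite coefXM coef_deriv mulr_natl; case: i => [|i]; first by rewrite mulr0n.
  by [].
have le_g : (size g <= d.+1)%N.
  by apply/leq_sizeP => i /f_coef fi; rewrite gE fi mulr0.
have -> : f^`().[x] = x * g.[x] by rewrite hornerM hornerX mulrA -expr2 x2 mul1r.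
rewrite (horner_sqr1 le_g x2) gE mul0r add0r mulrDr mulrA -expr2 x2 mul1r.
by congr (_ * _ + _); apply: eq_bigr.
Qed.

(** Blocks of six suit a sum in which powers of x have period 2 and binomial coefficients modulo 3
    have period 3. *)
Lemma big_nat_mul6 (R : nmodType) (F : nat -> R) n :
  \sum_(0 <= i < 6 * n) F i = \sum_(0 <= j < n) \sum_(k < 6) F (6 * j + k)%N.
Proof.
elim: n => [|n IHn]; first by rewrite !big_geq.
rewrite [RHS]big_nat_recr //= -IHn (@big_cat_nat _ _ _ (6 * n)) ?leq_pmul2l //=.
congr (_ + _); rewrite -{1}[(6 * n)%N]add0n big_addn -mulnBr subSnn muln1 big_mkord.
by apply: eq_bigr => i _; rewrite addnC.
Qed.

(** In F_3 one has 2 = -1, so halving is negation. *)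
Lemma F3_bin2 m : 'C(m.+2, 2)%:R = - (m%:R + 2) * (m%:R + 1) :> 'F_3.
Proof.
have binE : ('C(m.+2, 2) * 2 = m.+2 * m.+1)%N by rewrite mulnC -mul_bin_diag bin1.
have: 'C(m.+2, 2)%:R * 2 = m.+2%:R * m.+1%:R :> 'F_3 by rewrite -!natrM binE.
rewrite [X in _ * X = _](_ : 2 = -1 :> 'F_3); last exact/eqP.
by rewrite mulrN1 -[m.+2]addn2 -[m.+1]addn1 !natrD mulNr => <-; rewrite opprK.
Qed.

(* 'C(m + 2, 2) is 1 modulo 3 if 3 divides m and 0 otherwise. *)
Lemma mod3_horner_nderiv2 (f : {poly Z3}) (d : nat) (x : Z3) :
    size f = d.+1 -> x ^+ 2 = 1 ->
  z3_mod3 f^`N(2).[x] = z3_mod3 (\sum_(0 <= j < d.+1) f`_(2 + 6 * j) +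
                                 x * \sum_(0 <= j < d.+1) f`_(5 + 6 * j)).
Proof.
move=> szf x2.
(* The crude bound pads the sum with zeros to d + 1 full blocks of six. *)
have le_f : (size f^`N(2) <= 6 * d.+1)%N.
  apply/leq_sizeP => j le_j; rewrite coef_nderivn nth_default ?mul0rn //.
  by rewrite szf; lia.
rewrite (horner_coef_wide _ le_f) -(big_mkord xpredT (fun i => _`_i * x ^+ i)).
rewrite big_nat_mul6 mulr_sumr -big_split /= !rmorph_sum; apply: eq_bigr => j _.
have x6 k : x ^+ (6 * j + k) = x ^+ k.
  by rewrite exprD exprM (exprM x 2 3) x2 !expr1n mul1r.
pose c k : 'F_3 := - ((k%:R + 2) * (k%:R + 1)).
have cE k : z3_mod3 f^`N(2)`_(6 * j + k) = z3_mod3 f`_(2 + (6 * j + k)) * c k.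
  rewrite coef_nderivn -[_ *+ 'C(_, _)]mulr_natr rmorphM rmorph_nat /= add2n F3_bin2.
  rewrite natrD natrM (_ : 6%:R = 0 :> 'F_3) ?mul0r ?add0r ?mulNr //.
  exact/eqP.
rewrite rmorph_sum (eq_bigr (fun k : 'I_6 =>
  z3_mod3 f`_(2 + (6 * j + k)) * c k * z3_mod3 x ^+ k)) => [|k _]; last first.
  by rewrite x6 rmorphM rmorphXn /= cE.
(* Only offsets 0 and 3 survive in each block, with powers 1 and x^3 = x. *)
have [c0 c3] : c 0 = 1 /\ c 3 = 1 by split; apply/eqP.
have [c1 c2 c4 c5] : [/\ c 1 = 0, c 2 = 0, c 4 = 0 & c 5 = 0] by split; apply/eqP.
rewrite !big_ord_recr big_ord0 /= c0 c1 c2 c3 c4 c5.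
rewrite !(mulr0, mul0r, addr0, add0r, mulr1).
rewrite -!rmorphXn -rmorphM -rmorphD /= exprS x2.
by rewrite mulr1 mulrC addn0 (_ : 2 + (6 * j + 3) = 5 + 6 * j)%N; last lia.
Qed.

(* Here A0 = 3u and A1 = 1 + 3v, so that p = u + v + 1 and q = u - v. *)
Lemma F3_table (D0 D1 a1 a2 u v S2 S5 : 'F_3) :
  let b := D0 + D1 in let c := D1 - D0 in
  let al := u - v + c * (u + v + 1) in
  let ga := c * b * a2 + c * (S2 + S5) * a1 ^+ 2 + (S2 - S5) * a1 ^+ 2 * b ^+ 2 in
  [&& a1 * b * c == 1, al != 0 & al != ga] =
  [|| [&& D0 == 0, D1 == 2, a1 == 1, v + 2 != 0 & v + 2 != a2 + S5],
      [&& D0 == 0, D1 == 1, a1 == 1, u + 2 != 0 & u + 2 != 2 * a2 + S2],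
      [&& D0 == 1, D1 == 0, a1 == 2, v + 2 != 0 & v + 2 != 2 * a2 + S5] |
      [&& D0 == 2, D1 == 0, a1 == 2, u + 2 != 0 & u + 2 != a2 + S2]].
Proof.
pose F3s : seq 'F_3 := [:: 0; 1; -1].
have F3s_all (P : pred 'F_3) : all P F3s -> forall x, P x.
  by rewrite /= andbT => /and3P[P0 P1 PN1] x; have [->|->|->] := F3_cases x.
pose all5 P := all (fun a2 => all (fun u => all (fun v => all (fun S2 =>
  all (fun S5 => P a2 u v S2 S5 : bool) F3s) F3s) F3s) F3s) F3s.
have all5P P : all5 P -> forall a2 u v S2 S5, P a2 u v S2 S5.
  rewrite /all5 => H x1 x2 x3 x4 x5; move: H => /F3s_all-/(_ x1)/F3s_all-/(_ x2).
  by move=> /F3s_all-/(_ x3)/F3s_all-/(_ x4)/F3s_all-/(_ x5).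
cbv zeta; apply/eqP; move: a2 u v S2 S5.
(* Since b c = D1^2 - D0^2, the product a1 b c is 1 exactly for the four triples (D0, D1, a1) of the
   table; for all other triples both sides are false. *)
have [->|->|->] := F3_cases D0; have [->|->|->] := F3_cases D1;
  have [->|->|->] := F3_cases a1; try by move=> *; exact: erefl.
all: by apply: all5P; vm_compute.
Qed.

(** * From the criterion to the four cases *)

Theorem theorem18 (d : nat) (f : {poly Z3}) (hd : size f = d.+1) (hf0 : f`_0 = 1) :
  let A0 : Z3 := \sum_(2 <= i < d.+1 | ~~ odd i) f`_i in
  let A1 : Z3 := \sum_(1 <= i < d.+1 | odd i) f`_i in
  let D0 : Z3 := \sum_(2 <= i < d.+1 | ~~ odd i) i%:R * f`_i in
  let D1 : Z3 := \sum_(1 <= i < d.+1 | odd i) i%:R * f`_i in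
  (* the coefficients vanish beyond d, so j <= d covers every nonzero term *)
  let S2 : Z3 := \sum_(0 <= j < d.+1) f`_(2 + 6 * j) in
  let S5 : Z3 := \sum_(0 <= j < d.+1) f`_(5 + 6 * j) in
  minimal_system (fun x : Z3 => f.[x]) <->
  z3_multiples 3 A0 /\
  z3_cong 3 A1 1 /\
  ( (z3_cong 3 D0 0 /\ z3_cong 3 D1 2 /\ z3_cong 3 f`_1 1 /\
     ~ z3_cong 9 (A1 + 5) 0 /\
     ~ z3_cong 9 (A1 + 5) (3 * f`_2 + 3 * S5))
 \/ (z3_cong 3 D0 0 /\ z3_cong 3 D1 1 /\ z3_cong 3 f`_1 1 /\
     ~ z3_cong 9 (A0 + 6) 0 /\
     ~ z3_cong 9 (A0 + 6) (6 * f`_2 + 3 * S2))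
 \/ (z3_cong 3 D0 1 /\ z3_cong 3 D1 0 /\ z3_cong 3 f`_1 2 /\
     ~ z3_cong 9 (A1 + 5) 0 /\
     ~ z3_cong 9 (A1 + 5) (6 * f`_2 + 3 * S5))
 \/ (z3_cong 3 D0 2 /\ z3_cong 3 D1 0 /\ z3_cong 3 f`_1 2 /\
     ~ z3_cong 9 (A0 + 6) 0 /\
     ~ z3_cong 9 (A0 + 6) (3 * f`_2 + 3 * S2)) ).
Proof.
move=> A0 A1 D0 D1 S2 S5.
have le_f : (size f <= d.+1)%N by rewrite hd.
have f0 : f.[0] = 1 by rewrite horner_coef0.
have [s1 sN1] : (1 : Z3) ^+ 2 = 1 /\ (-1 : Z3) ^+ 2 = 1 by rewrite sqrrN expr1n.
have f1 : f.[1] = 1 + A0 + A1 by rewrite (horner_sqr1 le_f s1) hf0 mul1r.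
have fN1 : f.[-1] = 1 + A0 - A1 by rewrite (horner_sqr1 le_f sN1) hf0 mulN1r.
have df1 : f^`().[1] = D0 + D1 by rewrite (horner_deriv_sqr1 le_f s1) mul1r.
have dfN1 : f^`().[-1] = D1 - D0.
  by rewrite (horner_deriv_sqr1 le_f sN1) mulN1r addrC.
have df0 : f^`().[0] = f`_1 by rewrite horner_coef0 coef_deriv mulr1n.
have nf0 : f^`N(2).[0] = f`_2 by rewrite horner_coef0 coef_nderivn mulr1n.
have nf1 : z3_mod3 f^`N(2).[1] = z3_mod3 S2 + z3_mod3 S5.
  by rewrite (mod3_horner_nderiv2 hd s1) mul1r rmorphD.
have nfN1 : z3_mod3 f^`N(2).[-1] = z3_mod3 S2 - z3_mod3 S5.
  by rewrite (mod3_horner_nderiv2 hd sN1) mulN1r rmorphB.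
(* The system 1 + A0 + A1 = -1, 1 + A0 - A1 = 0 over F_3 has the single solution A0 = 0, A1 = 1. *)
have A_mod3 : minimal_system (horner f) -> z3_mod3 A0 = 0 /\ z3_mod3 A1 = 1.
  case/(minimal_mod3 f0); rewrite f1 fN1 rmorphB !rmorphD rmorph1 /=.
  have [->|->|->] := F3_cases (z3_mod3 A0);
  have [->|->|->] := F3_cases (z3_mod3 A1);
    by move=> /eqP ? /eqP ?.
have A0P : z3_multiples 3 A0 <-> exists u, A0 = 3 * u.
  by split=> [[u _ <-]|[u ->]]; exists u.
have A1P : z3_cong 3 A1 1 <-> exists v, A1 = 1 + 3 * v.
  rewrite z3_cong3E; split=> [/eqP/z3_mod3_eq //|[v ->]].
  by rewrite rmorphD /= z3_mod3_3M addr0.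
set cases := (X in _ <-> _ /\ (_ /\ X)).
suff table u v : A0 = 3 * u -> A1 = 1 + 3 * v ->
    minimal_system (horner f) <-> cases.
  split=> [f_min|[/A0P[u A0E] [/A1P[v A1E]]]]; last by move/(table u v A0E A1E).
  have [/z3_mod3_eq0[u A0E] A1_1] := A_mod3 f_min.
  have [|v A1E] := @z3_mod3_eq A1 1; first by rewrite A1_1 rmorph1.
  split; first by apply/A0P; exists u.
  split; first by apply/A1P; exists v.
  exact/(table u v A0E A1E).
move=> A0E A1E.
have f1E : f.[1] = -1 + 3 * (u + v + 1) by rewrite f1 A0E A1E; ring.
have fN1E : f.[-1] = 3 * (u - v) by rewrite fN1 A0E A1E; ring.
have A1_5 : A1 + 5 = 3 * (v + 2) by rewrite A1E; ring.
have A0_6 : A0 + 6 = 3 * (u + 2) by rewrite A0E; ring.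
have E5 : 3 * f`_2 + 3 * S5 = 3 * (f`_2 + S5) by rewrite mulrDr.
have E5' : 6 * f`_2 + 3 * S5 = 3 * (2 * f`_2 + S5) by ring.
have E2 : 3 * f`_2 + 3 * S2 = 3 * (f`_2 + S2) by rewrite mulrDr.
have E2' : 6 * f`_2 + 3 * S2 = 3 * (2 * f`_2 + S2) by ring.
rewrite (minimal_criterion f0 f1E fN1E) df0 df1 dfN1 nf0.
(* Writing 0 as 3 * 0 brings the conditions modulo 9 into the form of [z3_cong9E]; the last [mulr0]
   restores the other zeros. *)
rewrite /cases A1_5 A0_6 E5 E5' E2 E2' -(mulr0 3) !z3_cong9E !z3_cong3E mulr0.
rewrite !expr2 !(rmorphM, rmorphD, rmorphN) /= nf1 nfN1 -!expr2.
rewrite !(rmorph0, rmorph1, rmorph_nat).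
have table := F3_table (z3_mod3 D0) (z3_mod3 D1) (z3_mod3 f`_1) (z3_mod3 f`_2)
  (z3_mod3 u) (z3_mod3 v) (z3_mod3 S2) (z3_mod3 S5).
cbv zeta in table; split=> [[abc al0 al_ga]|cond].
  move: table; rewrite abc eqxx al0 al_ga /= => /esym/or4P[];
    case/and5P=> -> -> -> /negP ? /negP ?.
  - by left.
  - by right; left.
  - by right; right; left.
  - by right; right; right.
move: table; set holds := (X in _ = X) => table.
suff: holds by rewrite -table => /and3P[/eqP].
rewrite /holds; apply/or4P.
case: cond => [|[|[|]]] [-> [-> [-> [/negP -> /negP ->]]]].
- exact: Or41.
- exact: Or42.
- exact: Or43.
- exact: Or44.
Qed.
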